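(* Let $\mu\in\mathrm{dom}(\alpha)$ be critical, $\alpha\in(1,2]$, with associated slowly varying function $L$. Assume that either $d>\frac{2\alpha}{\alpha-1}$, or $d=\frac{2\alpha}{\alpha-1}$ and $\sum_{n\ge1}\frac{L(n^{2/(\alpha-1)})}{n}<+\infty$, and that $\theta$ has a finite moment of order $d-1$. Then for all finite sets $A\subset\mathbb Z^d$, $$\mathrm{BCap}(A):=\sum_{a\in A}\mathbb P(\mathcal T_+^a\cap A=\emptyset)=\sum_{a\in A}\mathbb P(\mathcal T_-^a\cap A=\emptyset).$$
   Context: Offspring distribution: $\mu$ is a probability distribution on $\mathbb N=\{0,1,2,\dots\}$, critical ($\sum_k k\mu(k)=1$, $\mu\neq\delta_1$); $\mu\in\mathrm{dom}(\alpha)$ means that $\mathrm{Gen}_\mu(s)=\sum_k\mu(k)s^k$ satisfies $\mathrm{Gen}_\mu(1-s)-(1-s)=s^\alpha L(1/s)$ for $s\in(0,1]$ with $L$ slowly varying at $+\infty$. Jump distribution: $\theta$ is centered on $\mathbb Z^d$ with invertible covariance matrix $\Sigma_\theta^2$; $\|x\|=|\Sigma_\theta^{-1}x|$ with $|\cdot|$ Euclidean. $g_\theta(x)=\sum_{n\ge0}\mathbb P_0(S_n=x)$ is the Green function of the random walk $S$ with $\theta$-jumps. Standing assumption: $g_\theta(x)\sim_{x\to\infty}C_\theta\|x\|^{2-d}$ with $C_\theta=\Gamma(\frac{d-2}2)/(2\sqrt{\det(\pi\Sigma_\theta^2)})$. Infinite tree $\mathcal T_\infty$: it has an infinite spine $(c_0,c_{-1},c_{-2},\dots)$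 in which $c_{-i-1}$ is the parent of $c_{-i}$ for all $i\ge0$. Independently for $k\ge1$, $c_{-k}$ has a number of children distributed according to $\mu'(j)=j\mu(j)$, and $c_{-k+1}$ is placed uniformly among these (ordered) children. All other vertices, including $c_0$, have independent numbers of (ordered) children with law $\mu$. Depth-first order $\preceq$: $u\preceq v$ iff $u$ is $v$ or an ancestor of $v$, or, with $w$ the last common ancestor of $u,v$, the child of $w$ equal to or an ancestor of $u$ comes before the child of $w$ equal to or an ancestor of $v$. Future and past: $\mathcal T_+=\{u\in\mathcal T_\infty:c_0\prec u\}$, $\mathcal T_-=\{u\in\mathcal T_\infty:u\prec c_0\}$ (so $\mathcal T_-$ contains the spine except $c_0$). The $\mathcal T_\infty$-walk $W^x_{\mathcal T_\infty}$ started at $x$ satisfies $W^x_{\mathcal T_\infty}(c_0)=x$ and has, given the tree, i.i.d. increments $W(u)-W(v)$ with law $\theta$ over edges from parent $v$ to child $u$. For $\mathcal V\subset\mathcal T_\infty$, $\mathcal V^x=\{W^x_{\mathcal T_\infty}(u):u\in\mathcal V\}$. *)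

(* Defs.v *)
From HB Require Import structures.
From mathcomp Require Import all_boot all_order all_algebra.
From mathcomp Require Import all_classical all_reals all_analysis.
Import Order.TTheory GRing.Theory Num.Theory.
Import numFieldNormedType.Exports.

Set Implicit Arguments.
Unset Strict Implicit.
Unset Printing Implicit Defensive.

Local Open Scope classical_set_scope.
Local Open Scope ring_scope.

Section DiscreteLaw.
Context {R : realType} {T : choiceType}.
Implicit Types (p : T -> R) (f : T -> R).

(* A law on a countable set is given by its mass function. *)
Definition is_law p : Prop :=
  (forall x, 0 <= p x) /\ (\esum_(x in [set: T]) (p x)%:E = 1)%E.

Definition integrable_law p f : Prop :=
  (\esum_(x in [set: T]) (p x * `|f x|)%:E < +oo)%E.

(* Expectation of [f], as positive part minus negative part; only meaningful
   when [integrable_law p f]. *)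
Definition mean p f : R :=
  fine (\esum_(x in [set: T]) (p x * Num.max (f x) 0)%:E)%E
  - fine (\esum_(x in [set: T]) (p x * Num.max (- f x) 0)%:E)%E.

End DiscreteLaw.

Section Offspring.
Context {R : realType}.
Implicit Types (mu : nat -> R) (L : R -> R).

Definition critical mu : Prop :=
  [/\ is_law mu,
      (\esum_(k in [set: nat]) (k%:R * mu k)%:E = 1)%E &
      mu <> (fun k => (k == 1%N)%:R)].

Definition Gen mu (s : R) : R := limn (series (fun k => mu k * s ^+ k)).

Definition slowly_varying L : Prop :=
  (exists X : R, (forall x, X <= x -> 0 < L x) /\ measurable_fun `[X, +oo[ L) /\
  (forall t : R, 0 < t -> L (t * x) / L x @[x --> +oo] --> (1 : R)).

(* [mu] belongs to dom(alpha), with associated slowly varying function [L]. *)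
Definition in_dom mu (alpha : R) L : Prop :=
  slowly_varying L /\
  (forall s : R, 0 < s -> s <= 1 ->
     Gen mu (1 - s) - (1 - s) = s `^ alpha * L s^-1).

Definition size_biased mu (j : nat) : R := j%:R * mu j.

End Offspring.

(* Points of Z^d are integer column vectors. *)

Section Jump.
Context {R : realType} {d : nat}.
Implicit Types (theta : 'cV[int]_d -> R) (Sigma : 'M[R]_d).

Definition toR (x : 'cV[int]_d) : 'cV[R]_d := map_mx intr x.

(* The library norm on matrices is the sup norm. *)
Definition euclid (v : 'cV[R]_d) : R := Num.sqrt (\sum_i v i ord0 ^+ 2).

Definition finite_moment theta (k : nat) : Prop :=
  (\esum_(x in [set: 'cV[int]_d]) (theta x * euclid (toR x) ^+ k)%:E < +oo)%E.

Definition centered theta : Prop :=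
  forall i, integrable_law theta (fun x => toR x i ord0) /\
            mean theta (fun x => toR x i ord0) = 0.

(* Covariance matrix of a centered law. *)
Definition covariance_mx theta : 'M[R]_d :=
  \matrix_(i, j) mean theta (fun x => toR x i ord0 * toR x j ord0).

Definition is_sqrt_mx Sigma (M : 'M[R]_d) : Prop :=
  [/\ Sigma^T = Sigma,
      (forall v : 'cV[R]_d, 0 <= (v^T *m Sigma *m v) ord0 ord0) &
      Sigma *m Sigma = M].

(* [theta] is a centered law on Z^d, whose covariance matrix Sigma^2 exists
   and is invertible. *)
Definition jump_law theta Sigma : Prop :=
  [/\ is_law theta, finite_moment theta 2, centered theta,
      covariance_mx theta \in unitmx & is_sqrt_mx Sigma (covariance_mx theta)].

Definition norm_Sigma Sigma (x : 'cV[int]_d) : R :=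
  euclid (invmx Sigma *m toR x).

(* P_0(S_n = x), i.e. the n-fold convolution of [theta]. *)
Fixpoint walk_law theta (n : nat) (x : 'cV[int]_d) : \bar R :=
  if n is n'.+1 then
    (\esum_(y in [set: 'cV[int]_d]) ((theta y)%:E * walk_law theta n' (x - y)))%E
  else ((x == 0)%:R)%:E.

Definition green theta (x : 'cV[int]_d) : \bar R :=
  (\sum_(0 <= n <oo) walk_law theta n x)%E.

(* Euler's integral. *)
Definition Gamma (z : R) : R :=
  Rintegral (@lebesgue_measure R) `]0, +oo[ (fun t => t `^ (z - 1) * expR (- t)).

Definition green_const theta : R :=
  Gamma ((d%:R - 2) / 2) / (2 * Num.sqrt (\det (pi *: covariance_mx theta))).

(* g_theta(x) ~ C_theta ||x||^(2-d) as x -> oo in Z^d.  Where the Green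
   function is infinite, [fine] is 0 and the inequality fails for eps < 1, so
   finiteness away from a bounded set is part of the condition. *)
Definition green_asymptotics theta Sigma : Prop :=
  forall eps : R, 0 < eps -> exists r : R, forall x : 'cV[int]_d,
    r <= euclid (toR x) ->
    `| fine (green theta x)
       / (green_const theta * norm_Sigma Sigma x `^ (2 - d%:R)) - 1 | <= eps.

End Jump.

(* Labels: [(k, [::])] is the spine vertex c_{-k}, and [(k, j :: w)] is the
   child of [(k, w)] having exactly [j] elder siblings.  The child c_{-k+1} of
   c_{-k} is only represented by [(k.-1, [::])]. *)
Definition label : choiceType := (nat * seq nat)%type.

Definition spine (k : nat) : label := (k, [::]).

Definition parent (u : label) : label :=
  if u is (k, _ :: w) then (k, w) else (u.1.+1, [::]).

(* [kids e u]: number of children of [u];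
   [heir e k], for k >= 1: number of elder siblings of c_{-k+1} among the
   children of c_{-k} ([heir e 0] is unused);
   [jump e u]: increment over the edge from the parent of [u] to [u].
   The values at labels that are not vertices of the tree are unused. *)
Record env (d : nat) := Env {
  kids : label -> nat;
  heir : nat -> nat;
  jump : label -> 'cV[int]_d }.

Section Tree.
Context {d : nat} (e : env d).

Fixpoint in_tree_at (k : nat) (w : seq nat) : bool :=
  if w is j :: w' then
    [&& in_tree_at k w', (j < kids e (k, w'))%N &
        ~~ [&& (0 < k)%N, w' == [::] & j == heir e k]]
  else true.

Definition tree : set label := [set u | in_tree_at u.1 u.2].

(* Number of elder siblings. *)
Definition birth_rank (u : label) : nat :=
  if u is (_, j :: _) then j else heir e u.1.+1.

(* [u] is [v] or an ancestor of [v]. *)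
Definition ancestor (u v : label) : Prop := exists n, u = iter n parent v.

Definition last_common_ancestor (w u v : label) : Prop :=
  [/\ ancestor w u, ancestor w v &
      forall w', ancestor w' u -> ancestor w' v -> ancestor w' w].

Definition df_le (u v : label) : Prop :=
  ancestor u v \/
  exists w u' v', [/\ last_common_ancestor w u v,
    (parent u' = w /\ ancestor u' u), (parent v' = w /\ ancestor v' v) &
    (birth_rank u' < birth_rank v')%N].

Definition df_lt (u v : label) : Prop := df_le u v /\ u <> v.

Definition future : set label := [set u | tree u /\ df_lt (spine 0) u].
Definition past : set label := [set u | tree u /\ df_lt u (spine 0)].

Fixpoint tree_walk_at (x : 'cV[int]_d) (k : nat) (w : seq nat) : 'cV[int]_d :=
  if w is j :: w' then tree_walk_at x k w' + jump e (k, j :: w')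
  else x - \sum_(i < k) jump e (spine i).

Definition tree_walk (x : 'cV[int]_d) (u : label) : 'cV[int]_d :=
  tree_walk_at x u.1 u.2.

Lemma tree_walk_root x : tree_walk x (spine 0) = x.
Proof. by rewrite /tree_walk /= big_ord0 subr0. Qed.

Lemma tree_walk_jump x u :
  tree_walk x u - tree_walk x (parent u) = jump e u.
Proof.
case: u => k [|j w]; rewrite /tree_walk /=; last by rewrite addrC addKr.
by rewrite big_ord_recr /= !opprD !opprK addrACA subrr add0r addKr.
Qed.

(* V^x *)
Definition visited (x : 'cV[int]_d) (V : set label) : set 'cV[int]_d :=
  tree_walk x @` V.

End Tree.

(* The independent coordinates of an environment: [inl u] is the reproduction
   at [u] (number of children, together with the rank of the spine child if
   [u] is c_{-k}, k >= 1), and [inr u] is the increment at [u]. *)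
Definition coord_type (d : nat) (i : label + label) : Type :=
  match i with inl _ => (nat * nat)%type | inr _ => 'cV[int]_d end.

Definition spine_child_rank (d : nat) (e : env d) (u : label) : nat :=
  if u is (k.+1, [::]) then heir e k.+1 else 0%N.

Definition env_coord (d : nat) (e : env d) (i : label + label) : coord_type d i :=
  match i with
  | inl u => (kids e u, spine_child_rank e u)
  | inr u => jump e u
  end.

Section RandomTree.
Context {R : realType} {d : nat} {dO : measure_display}
  {Omega : measurableType dO} (P : probability Omega R).

(* Mutual independence of random variables with values in discrete spaces. *)
Definition independent_family (I : eqType) (T : I -> Type)
    (X : forall i, Omega -> T i) : Prop :=
  (forall i (B : set (T i)), measurable (X i @^-1` B)) /\
  (forall (s : seq I) (B : forall i, set (T i)), uniq s ->
     P (\bigcap_(i in [set` s]) (X i @^-1` B i))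
     = (\prod_(i <- s) P (X i @^-1` B i))%E).

(* On the spine (k >= 1), the number of children has the size-biased law mu'
   and, given it, the rank of the heir is uniform.  The increments are drawn at
   all labels independently of the reproductions, hence are i.i.d. given the
   tree. *)
Definition is_Tinfty_walk (mu : nat -> R) (theta : 'cV[int]_d -> R)
    (E : Omega -> env d) : Prop :=
  [/\ independent_family (fun (i : label + label) om => env_coord (E om) i),
      (forall k j i, (0 < k)%N ->
         P [set om | kids (E om) (spine k) = j /\ heir (E om) k = i]
         = (size_biased mu j * ((i < j)%N%:R / j%:R))%:E),
      (forall u j, (forall k, (0 < k)%N -> u <> spine k) ->
         P [set om | kids (E om) u = j] = (mu j)%:E) &
      (forall u x, P [set om | jump (E om) u = x] = (theta x)%:E)].

Definition BCap (E : Omega -> env d) (A : set 'cV[int]_d) : \bar R :=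
  (\sum_(a \in A)
     P [set om | (visited (E om) a (future (E om)) `&` A = set0)%classic])%E.

End RandomTree.

(* Main.v *)
Require Import Defs.
From HB Require Import structures.
From mathcomp Require Import all_boot all_order all_algebra.
From mathcomp Require Import all_classical all_reals all_analysis.
From mathcomp Require Import zify lra.
Import Order.TTheory GRing.Theory Num.Theory.
Import numFieldNormedType.Exports.

Set Implicit Arguments.
Unset Strict Implicit.
Unset Printing Implicit Defensive.

Local Open Scope classical_set_scope.
Local Open Scope ring_scope.

(** The identity is an exchange of last and first visits to A.  Give every point
of Z^d weight one and start from it a critical Bienayme-Galton-Watson tree,
with a walk along its edges, cut at generation n.  The total weight of the
trees that meet A can be computed in two ways.  Decompose according to the
first visit to A in depth-first order: if it takes place at generation i at a
point a of A, the ancestors of the visiting vertex and the branches to the left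
of its ancestral line avoid A.  By the many-to-one principle the line from that
vertex up to the root has the law of the first i steps of the spine of
T_infinity: a vertex with j children, one of which is singled out, has weight
mu(j) for each choice of the child, exactly as for a size-biased number of
children and a uniform heir.  So the visits at generation i contribute the
probability past (i, n - i) that c_{-1}, ..., c_{-i}, together with the branches
to the left of the spine that grow from them, cut n - i generations below c_0,
avoid A.  Decomposing according to the last visit gives in the same way the
probabilities future (i, n - i).  Hence, summing over a in A,

     sum_(i <= n) past (i, n - i) = sum_(i <= n) future (i, n - i)   for all n.

Both arrays decrease in each index, and their limits are the two sides of the
identity.  The averages along antidiagonals have the same limits, so the two
limits agree.

The decomposition is carried out on generating functions rather than on trees.
Let hit h z be the probability that the tree of height h started at z meets A,
and Q the transition operator of the walk going down an edge.  The branching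
property gives two renewal equations,

     hit (h+1) = 1_A + 1_(A^c) bush_h Q(hit h)
               = 1_A progeny_(h+1) + bush_h Q(hit h),

where bush_h z is the mean probability that the branches on one side of the
spine avoid A (hit_past, hit_future; both come from progeny_weightS, that is,
from 1 - q^k = (1 - q) (1 + q + ... + q^(k-1))).  Iterating either of them
against the adjoint of Q (renewal_pairing) expands sum_z hit n z into an
antidiagonal sum, whose terms are identified with probabilities by independence
(P_past, P_future).  The terms of these sums are nonnegative, so they can be
rearranged at will; continuity of P along decreasing events and
antidiagonal_cesaro_le give the limits (limit_le). *)

(** * Sums over arbitrary index sets *)

Section Esum.
Context {R : realType} {T : choiceType}.
Local Open Scope ereal_scope.

Lemma esumZl_le (c : R) (f : T -> \bar R) : (0 <= c)%R -> (forall x, 0 <= f x) ->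
  \esum_(x in setT) (c%:E * f x) <= c%:E * \esum_(x in setT) f x.
Proof.
move=> c0 f0; apply: ge_ereal_sup => _ [/= X [finX _] <-].
rewrite -ge0_mule_fsumr; last by move=> x; exact: f0.
by apply: lee_wpmul2l; rewrite ?lee_fin//; apply: ereal_sup_ubound; exists X.
Qed.

Lemma esumZl (c : \bar R) (f : T -> \bar R) : 0 <= c -> (forall x, 0 <= f x) ->
  \esum_(x in setT) (c * f x) = c * \esum_(x in setT) f x.
Proof.
move=> c0 f0.
have [f_eq0|/existsNP[x /eqP fx0]] := pselect (forall x, f x = 0).
  by rewrite !esum1 ?mule0// => x _; rewrite f_eq0 ?mule0.
have sum_gt0 : 0 < \esum_(x in setT) f x.
  apply: (@lt_le_trans _ _ (f x)); first by rewrite lt0e fx0 f0.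
  by apply: esum_ge; exists [set x]; rewrite ?fsbig_set1.
case: c c0 => [c||]//= c0; last first.
  rewrite gt0_mulye//; apply/eqP; rewrite -leye_eq; apply: esum_ge.
  by exists [set x]; rewrite ?fsbig_set1 ?gt0_mulye// lt0e fx0 f0.
apply/eqP; rewrite eq_le esumZl_le//=.
have [->|c_neq0] := eqVneq c 0%R.
  by rewrite mul0e esum_ge0// => ? _; rewrite mul0e.
have c_gt0 : (0 < c)%R by rewrite lt_neqAle eq_sym c_neq0.
rewrite -lee_pdivlMl//.
have cf0 y : 0 <= c%:E * f y by rewrite mule_ge0.
apply: le_trans (esumZl_le _ cf0); last by rewrite invr_ge0.
by apply: le_esum => y _; rewrite muleA -EFinM mulVf// mul1e.
Qed.

Lemma esum_exchange {T' : choiceType} (f : T -> T' -> \bar R) :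
  (forall x y, 0 <= f x y) ->
  \esum_(x in setT) \esum_(y in setT) f x y =
  \esum_(y in setT) \esum_(x in setT) f x y.
Proof.
move=> f0; rewrite !esum_esum//.
apply: (@reindex_esum _ _ _ _ _ (fun z : T' * T => (z.2, z.1))).
split=> //; first by move=> [? ?] [? ?] _ _ [-> ->].
by move=> [x y] _; exists (y, x).
Qed.

End Esum.

Lemma esum_shift {R : realType} {V : choiceType} (a : V -> \bar R) (s : V -> V) :
  bijective s ->
  (\esum_(x in setT) a x = \esum_(x in setT) a (s x))%E.
Proof. by move=> [s' sK s'K]; apply: reindex_esum; rewrite setTT_bijective; exists s'. Qed.

Lemma esum_lt {R : realType} j (p : nat -> \bar R) : (forall i, 0 <= p i)%E ->
  (\esum_(i in [set: nat]) ((i < j)%N%:R%:E * p i) = \sum_(i < j) p i)%E.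
Proof.
move=> p0; rewrite -nneseries_esumT; last by move=> i; rewrite mule_ge0 ?lee_fin.
rewrite (nneseries_split 0 j)//; last by move=> i; rewrite mule_ge0 ?lee_fin.
rewrite eseries0 ?adde0 ?add0n; last by move=> i ji _; rewrite ltnNge ji mul0e.
by rewrite big_mkord; apply: eq_bigr => i _; rewrite ltn_ord mul1e.
Qed.

(** * Renewal equations tested against the adjoint walk *)

Section Pairing.
Context {R : realType} {V : zmodType} (theta : V -> R).
Hypothesis theta_ge0 : forall y, 0 <= theta y.
Local Open Scope ereal_scope.
Implicit Types f g u c : V -> \bar R.

Definition forward_mean u x := \esum_(y in setT) ((theta y)%:E * u (x + y)%R).
Definition backward_mean u x := \esum_(y in setT) ((theta y)%:E * u (x - y)%R).

Lemma forward_mean_ge0 u x : (forall y, 0 <= u y) -> 0 <= forward_mean u x.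
Proof. by move=> u0; apply: esum_ge0 => y _; rewrite mule_ge0 ?lee_fin. Qed.

Lemma backward_mean_ge0 u x : (forall y, 0 <= u y) -> 0 <= backward_mean u x.
Proof. by move=> u0; apply: esum_ge0 => y _; rewrite mule_ge0 ?lee_fin. Qed.

(** Substitute x + y for x: going down an edge against u amounts to going up
the same edge against f. *)
Lemma mean_adjoint u f : (forall x, 0 <= u x) -> (forall x, 0 <= f x) ->
  \esum_(x in setT) (f x * forward_mean u x) =
  \esum_(x in setT) (u x * backward_mean f x).
Proof.
move=> u0 f0.
under eq_esum => x _.
  rewrite /forward_mean -esumZl//; last by move=> y; rewrite mule_ge0 ?lee_fin.
  over.
under [RHS]eq_esum => x _.
  rewrite /backward_mean -esumZl//; last by move=> y; rewrite mule_ge0 ?lee_fin.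
  over.
rewrite esum_exchange; last by move=> x y; rewrite !mule_ge0 ?lee_fin.
rewrite [RHS]esum_exchange; last by move=> x y; rewrite !mule_ge0 ?lee_fin.
apply: eq_esum => y _.
rewrite [RHS](@esum_shift _ _ _ (fun x => (x + y)%R)); last first.
  by exists (fun x => (x - y)%R) => x; rewrite ?addrK ?subrK.
by apply: eq_esum => x _; rewrite addrK muleCA [in RHS]muleCA; congr (_ * _); rewrite muleC.
Qed.

Variables (u c g : nat -> V -> \bar R).
Hypotheses (u_ge0 : forall n x, 0 <= u n x) (c_ge0 : forall n x, 0 <= c n x)
  (g_ge0 : forall n x, 0 <= g n x).
Hypothesis u0 : u 0 =1 c 0.
Hypothesis uS : forall n x, u n.+1 x = c n.+1 x + g n x * forward_mean (u n) x.

(** The walk climbs m edges, and the vertex reached by the i-th step gets the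
factor g (h + i - 1): the higher a spine vertex, the more generations separate it
from the fixed lowest level, so the taller the branches hanging from it. *)
Fixpoint spine_weight (m h : nat) : V -> \bar R :=
  if m is m'.+1 then
    backward_mean (fun x => g h x * spine_weight m' h.+1 x)
  else fun=> 1.

Lemma spine_weight_ge0 m h x : 0 <= spine_weight m h x.
Proof.
elim: m h x => [|m IH] h x /=; first exact: lee01.
by apply: backward_mean_ge0 => y; rewrite mule_ge0.
Qed.

(** Each use of the recursion for u peels off the term c n and moves one step up
the spine; m + n is preserved, whence the sum along an antidiagonal. *)
Lemma renewal_pairing m n :
  \esum_(x in setT) (u n x * spine_weight m n x) =
  \sum_(i < n.+1) \esum_(x in setT) (c (n - i)%N x * spine_weight (m + i) (n - i) x).
Proof.
elim: n m => [|n IH] m.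
  by rewrite big_ord_recl big_ord0 adde0 addn0; apply: eq_esum => x _; rewrite u0.
rewrite big_ord_recl/= addn0 subn0.
under eq_esum => x _.
  rewrite uS ge0_muleDl//; last by rewrite mule_ge0 ?forward_mean_ge0.
  rewrite muleAC; over.
rewrite esumD; last 2 first.
- by move=> x _; rewrite mule_ge0 ?spine_weight_ge0.
- by move=> x _; rewrite !mule_ge0 ?forward_mean_ge0 ?spine_weight_ge0.
congr (_ + _).
rewrite mean_adjoint//; last by move=> x; rewrite mule_ge0 ?spine_weight_ge0.
rewrite (IH m.+1); apply: eq_bigr => i _.
by rewrite /bump /= add1n subSS addnS.
Qed.

End Pairing.

(** * Averages along antidiagonals *)

Section Cesaro.
Context {R : realType}.

(** The entries of a exceed a N N by a bounded amount, and do so on an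
antidiagonal only when one of the indices is less than N, hence at most 2N
times; so the average of a along the n-th antidiagonal is eventually below
any number larger than alpha, whereas the average of b is at least beta. *)
Lemma antidiagonal_cesaro_le (a b : nat -> nat -> R) (alpha beta : R) :
  (forall m h m' h', (m <= m')%N -> (h <= h')%N -> a m' h' <= a m h) ->
  (forall m h, beta <= b m h) ->
  (forall n, \sum_(i < n.+1) a i (n - i)%N = \sum_(i < n.+1) b i (n - i)%N) ->
  (fun n => a n n) @ \oo --> alpha -> beta <= alpha.
Proof.
move=> a_decr b_ge eq_ab a_cvg; rewrite leNgt; apply/negP => alpha_lt_beta.
pose e := (beta - alpha) / 2.
have e_gt0 : 0 < e by rewrite /e; lra.
have [N _ aN] : \forall n \near \oo, a n n < alpha + e.
  apply: (cvgr_lt alpha) => //; lra.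
have {}aN : a N N < alpha + e by apply: aN => /=.
(* M bounds how much an entry can exceed alpha + e. *)
pose M := `|a 0%N 0%N| + `|alpha + e| .
have bound n : \sum_(i < n.+1) a i (n - i)%N <= n.+1%:R * (alpha + e) + (N.*2)%:R * M.
  have term i : (i <= n)%N -> a i (n - i)%N <= (alpha + e) + ((i < N) + (n - i < N))%:R * M.
    move=> i_le; have [iN|iN] := ltnP i N; last first.
      have [niN|niN] := ltnP (n - i) N; last first.
        rewrite mul0r addr0; apply: le_trans (ltW aN).
        exact: a_decr.
      rewrite add0n mul1r /M; have := a_decr 0%N 0%N i (n - i)%N (leq0n _) (leq0n _).
      by have := ler_norm (a 0%N 0%N); have := ler_norm (- (alpha + e)); rewrite normrN; lra.
    have := a_decr 0%N 0%N i (n - i)%N (leq0n _) (leq0n _).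
    have := ler_norm (a 0%N 0%N); have := ler_norm (- (alpha + e)); rewrite normrN.
    have M0 : 0 <= M by rewrite addr_ge0.
    have : M <= (true + (n - i < N))%:R * M by rewrite ler_peMl// ler1n.
    by rewrite /M; lra.
  apply: (@le_trans _ _ (\sum_(i < n.+1) ((alpha + e) + ((i < N) + (n - i < N))%:R * M))).
    by apply: ler_sum => i _; apply: term; rewrite -ltnS.
  rewrite big_split /= sumr_const card_ord [n.+1%:R * _]mulr_natl lerD2l -mulr_suml.
  rewrite ler_wpM2r ?addr_ge0// -natr_sum ler_nat big_split /= -addnn.
  have countN : (\sum_(i < n.+1) (i < N) <= N)%N.
    elim: n.+1 => [|k IHk]; first by rewrite big_ord0.
    have : (\sum_(i < k) (i < N) <= k)%N.
      by rewrite -[leqRHS]card_ord -sum1_card; apply: leq_sum => i _; case: ltnP.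
    rewrite big_ord_recr /=; move: (\sum_(i < k) _)%N IHk => c cN ck.
    by case: (ltnP k N) => kN; rewrite ?addn1 ?addn0// (leq_ltn_trans ck).
  apply: leq_add => //; rewrite (reindex_inj rev_ord_inj) /=.
  apply: leq_trans countN; apply: eq_leq; apply: eq_bigr => i _.
  by rewrite subSS subKn // -ltnS.
have lower n : n.+1%:R * beta <= \sum_(i < n.+1) b i (n - i)%N.
  by rewrite mulr_natl -[X in _ *+ X](card_ord n.+1) -sumr_const; exact: ler_sum.
have key n : n.+1%:R * e <= (N.*2)%:R * M.
  have := lower n; rewrite -eq_ab => /le_trans /(_ (bound n)).
  have -> : beta = alpha + e + e by rewrite /e; lra.
  by rewrite mulrDr lerD2l.
have := key (Num.truncn ((N.*2)%:R * M / e)).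
rewrite -ler_pdivlMr// leNgt => /negP; apply.
exact: truncnS_gt.
Qed.

End Cesaro.

(** * Events depending on disjoint sets of coordinates *)

Section Independence.
Context {R : realType} {dO : measure_display} {Omega : measurableType dO}
  (P : probability Omega R) {I : eqType} {T : I -> Type}
  (X : forall i, Omega -> T i).
Hypothesis indepX : independent_family P X.
Implicit Types (S : set I) (F G : set Omega).

Definition cylinder (s : seq I) (B : forall i, set (T i)) : set Omega :=
  \bigcap_(i in [set` s]) (X i @^-1` B i).

Definition cylinders S : set (set Omega) :=
  [set F | exists s B, (forall i, i \in s -> S i) /\ F = cylinder s B].

(** The sigma-algebra generated by the coordinates in S.  It is wrapped in an
inductive predicate so that unification does not unfold it to a quantification
over all sigma-algebras. *)
Variant determined_by S F : Prop := Determined of <<s cylinders S >> F.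

Lemma determined_cylinders S F : cylinders S F -> determined_by S F.
Proof. by move=> CF; split; exact: sub_gen_smallest. Qed.

Lemma cylinderI s B t C :
  cylinder s B `&` cylinder t C =
  cylinder (undup (s ++ t))
    (fun i => [set x | (i \in s -> B i x) /\ (i \in t -> C i x)]).
Proof.
apply/seteqP; split=> om /=.
  move=> [omB omC] i /=; rewrite mem_undup mem_cat => _.
  by split=> [/omB|/omC].
move=> H; split=> i /= ii; have := H i;
  rewrite /= mem_undup mem_cat ii ?orbT => /(_ isT)[].
  by move=> /(_ isT).
by move=> _ /(_ isT).
Qed.

Lemma setI_closed_cylinders S : setI_closed (cylinders S).
Proof.
move=> _ _ [s [B [sS ->]]] [t [C [tS ->]]]; rewrite cylinderI.
exists (undup (s ++ t)); eexists; split; last by [].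
by move=> i; rewrite mem_undup mem_cat => /orP[/sS|/tS].
Qed.

Lemma cylinder_uniq s B : cylinder s B = cylinder (undup s) B.
Proof. by apply/seteqP; split=> om H i /= ii; apply: H; rewrite /= ?mem_undup// -mem_undup. Qed.

Lemma measurable_cylinder s B : measurable (cylinder s B).
Proof. by apply: fin_bigcap_measurable => // i _; apply: indepX.1. Qed.

Lemma measurable_determined S F : determined_by S F -> measurable F.
Proof.
case; move: F; apply: smallest_sub; first exact: sigma_algebra_measurable.
by move=> _ [s [B [_ ->]]]; exact: measurable_cylinder.
Qed.

Lemma P_cylinderI s B t C : (forall i, i \in s -> i \in t -> False) ->
  (P (cylinder s B `&` cylinder t C) = P (cylinder s B) * P (cylinder t C))%E.
Proof.
move=> st; rewrite (cylinder_uniq s) (cylinder_uniq t).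
have dis i : i \in undup s -> i \in undup t -> False by rewrite !mem_undup; exact: st.
move: (undup_uniq s) (undup_uniq t) dis; move: (undup s) (undup t) => {st}s' t' us ut dis.
pose D i := [set x | (i \in s' -> B i x) /\ (i \in t' -> C i x)].
have -> : cylinder s' B `&` cylinder t' C = cylinder (s' ++ t') D.
  apply/seteqP; split=> om /=.
    by move=> [omB omC] i /= _; split=> [/omB|/omC].
  move=> H; split=> i /= ii; have := H i; rewrite /= mem_cat ii ?orbT => /(_ isT)[].
    by move=> /(_ ii).
  by move=> _ /(_ ii).
rewrite /cylinder !indepX.2// ?cat_uniq ?us ?ut ?andbT; last first.
  by apply/hasPn => i it; apply/negP => /dis; apply.
rewrite big_cat /=; congr (_ * _)%E; apply: eq_big_seq => i ii; congr (P _);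
  apply/seteqP; split=> om /=; rewrite /D /=; try tauto; move=> ?; split=> // jj.
  by case: (dis i).
by case: (dis i).
Qed.

(** The events independent of G form a Dynkin system. *)
Lemma indep_extend (G : set Omega) (C : set (set Omega)) :
  measurable G -> setI_closed C -> (forall F, C F -> measurable F) ->
  (forall F, C F -> P (F `&` G) = P F * P G)%E ->
  forall F, <<s C >> F -> (P (F `&` G) = P F * P G)%E.
Proof.
move=> mG CI mC CG.
suff: <<s C >> `<=` [set F | measurable F /\ (P (F `&` G) = P F * P G)%E].
  by move=> H F /H[].
have PG_fin : P G \is a fin_num by rewrite fin_num_measure.
apply: lambda_system_subset; [by []| | |by []]; last first.
  by move=> F CF; split; [exact: mC|exact: CG].
apply/dynkin_lambda_system; split.
- by split; rewrite ?setTI ?probability_setT ?mul1e.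
- move=> F [mF FG]; split; first exact: measurableC.
  have -> : P (~` F `&` G) = (P G - P (F `&` G))%E.
    by rewrite setIC -setDE setIC measureD// ltey_eq fin_num_measure.
  rewrite FG [P (~` F)]probability_setC//.
  by rewrite muleBl ?mul1e// ?fin_num_measure// fin_num_adde_defl.
- move=> F tF HF; have mF n : measurable (F n) by have [] := HF n.
  split; first exact: bigcupT_measurable.
  rewrite setI_bigcupl measure_bigcup//=; last 2 first.
  + by move=> i _; exact: measurableI.
  + exact: trivIset_setIr.
  rewrite measure_bigcup//=.
  rewrite muleC -(fineK PG_fin) -nneseriesZl//; apply: eq_eseriesr => n _.
  by rewrite muleC fineK// (HF n).2.
Qed.

(** The Dynkin argument is applied once on each side, starting from cylinders,
for which independence is the hypothesis on X. *)
Lemma determined_indep S S' F G : (forall i, S i -> S' i -> False) ->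
  determined_by S F -> determined_by S' G -> (P (F `&` G) = P F * P G)%E.
Proof.
move=> SS' [SF] [S'G]; move: F SF; apply: indep_extend.
- by apply: (@measurable_determined S'); split.
- exact: setI_closed_cylinders.
- by move=> F CF; apply: (@measurable_determined S); exact: determined_cylinders.
move=> F [s [B [sS ->]]]; rewrite setIC muleC; move: G S'G; apply: indep_extend.
- exact: measurable_cylinder.
- exact: setI_closed_cylinders.
- by move=> G CG; apply: (@measurable_determined S'); exact: determined_cylinders.
by move=> G [t [C [tS' ->]]]; apply: P_cylinderI => i /tS' iS' /sS /SS'; exact.
Qed.

Lemma determined_coord S i (B : set (T i)) : S i -> determined_by S (X i @^-1` B).
Proof.
move=> Si; apply: determined_cylinders.
(* A family of sets equal to B at i; the transport along e : j = i is what
   makes it typecheck at the other coordinates. *)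
exists [:: i], (fun j => [set x | forall e : j = i, B (eq_rect j T x i e)]); split.
  by move=> j /[!inE] /eqP ->.
apply/seteqP; split=> om /=.
  by move=> BX j /= /[!inE] /eqP -> e; rewrite (eq_axiomK e).
by move=> /(_ i (mem_head _ _)) /(_ erefl).
Qed.

Lemma determined_sub S S' F : S `<=` S' -> determined_by S F -> determined_by S' F.
Proof.
move=> SS' [SF]; split; move: F SF; apply: sub_smallest2r; first exact: smallest_sigma_algebra.
move=> _ [s [B [sS ->]]].
by exists s, B; split=> // i /sS /SS'.
Qed.

Section Closure.
Context {S : set I}.

Lemma determinedT : determined_by S [set: Omega].
Proof.
have [D0 DC _] := @smallest_sigma_algebra _ setT (cylinders S).
by split; have := DC _ D0; rewrite setD0.
Qed.

Lemma determinedC F : determined_by S F -> determined_by S (~` F).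
Proof.
have [_ DC _] := @smallest_sigma_algebra _ setT (cylinders S).
by case=> SF; split; have := DC _ SF; rewrite setTD.
Qed.

Lemma determined_bigcup (J : countType) (F : J -> set Omega) :
  (forall j, determined_by S (F j)) -> determined_by S (\bigcup_j F j).
Proof.
have [D0 _ DU] := @smallest_sigma_algebra _ setT (cylinders S).
move=> SF; rewrite (_ : \bigcup_j F j =
    \bigcup_n (if unpickle n is Some j then F j else set0)).
  by split; apply: DU => n; case: unpickle => // j; case: (SF j).
apply/seteqP; split=> om [].
  by move=> j _ Fj; exists (pickle j) => //; rewrite pickleK.
by move=> n _; case: unpickle => // j Fj; exists j.
Qed.

(** The conditions defining the tree events are written with quantifiers over
countable types and implications; this lemma and the two on implications show
that they are determined by the coordinates they mention. *)
Lemma determined_forall (J : countType) (F : J -> set Omega) :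
  (forall j, determined_by S (F j)) -> determined_by S [set om | forall j, F j om].
Proof.
move=> SF; rewrite (_ : mkset _ = ~` \bigcup_j ~` F j).
  by apply: determinedC; apply: determined_bigcup => j; exact: determinedC.
rewrite setC_bigcup; apply/seteqP; split=> om /=.
  by move=> H j _ /=; apply; exact: H.
by move=> H j; apply: contrapT; exact: H.
Qed.

Lemma determinedI F G : determined_by S F -> determined_by S G -> determined_by S (F `&` G).
Proof.
move=> SF SG; rewrite (_ : F `&` G = [set om | forall b, (if b then F else G) om]).
  by apply: determined_forall => -[].
apply/seteqP; split=> om /=; first by move=> [Fom Gom] [].
by move=> H; split; [exact: (H true)|exact: (H false)].
Qed.

Lemma determined_const (Q : Prop) : determined_by S [set om | Q].
Proof.
have [q|nq] := pselect Q.
  by rewrite (_ : mkset _ = setT); [exact: determinedT|apply/seteqP; split].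
rewrite (_ : mkset _ = ~` setT); first by apply: determinedC; exact: determinedT.
by rewrite setCT; apply/seteqP; split.
Qed.

Lemma determined_imp F G : determined_by S F -> determined_by S G ->
  determined_by S [set om | F om -> G om].
Proof.
move=> SF SG; rewrite (_ : mkset _ = ~` (F `&` ~` G)).
  by apply: determinedC; apply: determinedI => //; exact: determinedC.
apply/seteqP; split=> om /=; first by move=> H [/H].
by move=> H Fom; apply: contrapT => Gom; exact: H.
Qed.

Lemma determined_if (Q : Prop) F :
  (Q -> determined_by S F) -> determined_by S [set om | Q -> F om].
Proof.
move=> SF; have [q|nq] := pselect Q.
  rewrite (_ : mkset _ = F); first exact: SF.
  by apply/seteqP; split=> om //= /(_ q).
rewrite (_ : mkset _ = setT); first exact: determinedT.
by apply/seteqP; split=> om // _ /nq.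
Qed.

End Closure.

Lemma P_forall_bounded n (c : pred nat) (S : nat -> set I) (F : nat -> set Omega) :
  (forall l l' i, S l i -> S l' i -> l = l') ->
  (forall l, determined_by (S l) (F l)) ->
  P [set om | forall l, (l < n)%N -> c l -> F l om] = (\prod_(l < n | c l) P (F l))%E.
Proof.
move=> disS SF; elim: n => [|n IH].
  rewrite big_ord0 (_ : mkset _ = setT) ?probability_setT//.
  by apply/seteqP; split.
rewrite big_mkcond big_ord_recr -big_mkcond /= -IH.
pose G := [set om | c n -> F n om].
have -> : [set om | forall l, (l < n.+1)%N -> c l -> F l om] =
    [set om | forall l, (l < n)%N -> c l -> F l om] `&` G.
  apply/seteqP; split=> om /=.
    by move=> H; split=> [l ln|]; apply: H; rewrite // ltnS ltnW.
  by move=> [H Hn] l; rewrite ltnS leq_eqVlt => /predU1P[->//|]; exact: H.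
rewrite (@determined_indep (\bigcup_(l < n) S l) (S n)).
- congr (_ * _)%E; rewrite /G; case: (c n).
    by congr (P _); apply/seteqP; split=> om //= /(_ isT).
  by rewrite (_ : mkset _ = setT) ?probability_setT//; apply/seteqP; split.
- by move=> i [l /= ln Sl] Sn; move: ln; rewrite (disS _ _ _ Sl Sn) ltnn.
- apply: determined_forall => l; apply: determined_if => ln.
  apply: determined_if => _; apply: (determined_sub _ (SF l)).
  by move=> i Si; exists l.
- by apply: determined_if => _.
Qed.

End Independence.

Lemma total_probability {R : realType} {dO : measure_display}
    {Omega : measurableType dO} (P : probability Omega R) (J : countType)
    (Y : Omega -> J) (F : set Omega) :
  (forall B, measurable (Y @^-1` B)) -> measurable F ->
  P F = (\esum_(y in [set: J]) P (Y @^-1` [set y] `&` F))%E.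
Proof.
move=> mY mF.
pose D n := Y @^-1` [set y | pickle y = n] `&` F.
have mD n : measurable (D n) by exact: measurableI.
have F_D : F = \bigcup_n D n.
  apply/seteqP; split=> om; last by case=> n _ [].
  by move=> Fom; exists (pickle (Y om)).
rewrite [in LHS]F_D measure_bigcup//; last first.
  by move=> i j _ _ [om [[/= <- _] [/= <- _]]].
rewrite nneseries_esum ?set_mem_set; last by move=> n _; exact: measure_ge0.
rewrite (esumID (range (@pickle J))) ?setTI; last by move=> *; exact: measure_ge0.
rewrite [X in (_ + X)%E]esum1 ?adde0; last first.
  move=> n nn; rewrite (_ : D n = set0) ?measure0//.
  by apply/seteqP; split=> om //= [/= e _]; apply: nn; exists (Y om).
rewrite (@reindex_esum _ _ _ setT _ (@pickle J)); last first.
  split; first by move=> y _; exists y.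
  - by move=> ? ? _ _; exact: (pcan_inj pickleK).
  - by [].
apply: eq_esum => y _; congr (P _); apply/seteqP; split=> om /= [+ Fom].
  by move=> /(pcan_inj pickleK) ->.
by move=> Yom; split=> //=; rewrite Yom.
Qed.

(** * Truncated trees avoiding a set *)

Section ClearEvents.
Context {d : nat} (e : env d) (A : set 'cV[int]_d).

Definition kid (u : label) (j : nat) : label := (u.1, j :: u.2).

(** The branch at u is the edge to u together with the descendants of u, here
at most h generations below u; the argument x is the position of the parent of
u.  Including the edge makes branches at siblings depend on disjoint sets
of coordinates. *)
Fixpoint branch_clear (h : nat) (u : label) (x : 'cV[int]_d) : Prop :=
  ~ A (x + jump e u) /\
  (if h is h'.+1 then
     forall j, (j < kids e u)%N -> branch_clear h' (kid u j) (x + jump e u)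
   else True).

Definition progeny_clear (h : nat) (u : label) (z : 'cV[int]_d) : Prop :=
  if h is h'.+1 then forall j, (j < kids e u)%N -> branch_clear h' (kid u j) z
  else True.

Lemma branch_clearE h u x :
  branch_clear h u x = (~ A (x + jump e u) /\ progeny_clear h u (x + jump e u)).
Proof. by case: h. Qed.

(** A bush consists of the branches growing from a spine vertex on one side of
the spine; side i l tells whether the child of rank l is on that side when the
spine child has rank i.  Asking for l < kids makes the event agree with the tree
even on the null event where the heir is not among the children. *)
Definition bush_clear (side : nat -> nat -> bool) (h k : nat) (z : 'cV[int]_d) : Prop :=
  forall l, (l < kids e (spine k))%N -> side (heir e k) l ->
    branch_clear h (kid (spine k) l) z.

(** From c_{-k} at y, climb m spine edges.  The spine vertices must avoid S
and the bushes on the given side must avoid A.  A branch at a child of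
c_{-k-1} is cut h generations below that child, that is, h levels below c_{-k};
climbing one edge raises h by one, so the cut stays at a fixed level. *)
Fixpoint spine_clear (side : nat -> nat -> bool) (S : set 'cV[int]_d)
    (m h k : nat) (y : 'cV[int]_d) : Prop :=
  if m is m'.+1 then
    let z := y - jump e (spine k) in
    ~ S z /\ bush_clear side h k.+1 z /\ spine_clear side S m' h.+1 k.+1 z
  else True.

End ClearEvents.

(** * Coordinates on which the truncated events depend *)

Section Coordinates.
Context {d : nat}.

Definition coord_label (i : label + label) : label :=
  match i with inl u | inr u => u end.

Definition branch_coords (u : label) : set (label + label) :=
  [set i | exists w, coord_label i = (u.1, w ++ u.2)].

Definition progeny_coords (u : label) : set (label + label) :=
  [set i | i = inl u \/ exists j, branch_coords (kid u j) i].

Definition spine_coords (k : nat) : set (label + label) :=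
  [set i | i = inr (spine k) \/ (k < (coord_label i).1)%N].

Lemma branch_coords_kid u j : branch_coords (kid u j) `<=` branch_coords u.
Proof. by move=> i [w wE]; exists (rcons w j); rewrite wE /= cat_rcons. Qed.

Lemma branch_coords_inj u j j' i :
  branch_coords (kid u j) i -> branch_coords (kid u j') i -> j = j'.
Proof.
move=> [w wE] [w']; rewrite wE => -[ww'].
have sz : size w = size w'.
  by move/(congr1 size): ww'; rewrite !size_cat /= => /eqP; rewrite eqn_add2r => /eqP.
by move/eqP: ww'; rewrite eqseq_cat// => /andP[_ /eqP[]].
Qed.

Lemma progeny_coordsN u : ~ progeny_coords u (inr u).
Proof.
move=> [//|[j [w /= ]]]; case: u => k u [/(congr1 size)].
by rewrite size_cat /= => /eqP; rewrite -[X in X == _]add0n -addSnnS eqn_add2r.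
Qed.

Lemma branch_coords_kidN u j : ~ branch_coords (kid u j) (inl u).
Proof.
move=> [w /= ]; case: u => k u [/(congr1 size)].
by rewrite size_cat /= => /eqP; rewrite -[X in X == _]add0n -addSnnS eqn_add2r.
Qed.
End Coordinates.

(** * Probabilities of the truncated events *)

Section Probabilities.
Context {R : realType} {d : nat} {dO : measure_display}
  {Omega : measurableType dO} (P : probability Omega R).
Variables (mu : nat -> R) (theta : 'cV[int]_d -> R) (E : Omega -> env d).
Variable A : set 'cV[int]_d.
Hypothesis TE : is_Tinfty_walk P mu theta E.
Local Open Scope ereal_scope.

Let X (i : label + label) om := env_coord (E om) i.

Let indepX : independent_family P X. Proof. by case: TE. Qed.

Lemma offspring_ge0 k : (0 <= mu k)%R.
Proof.
case: TE => _ _ /(_ (spine 0) k) H _.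
by rewrite -lee_fin -H ?measure_ge0// => -[].
Qed.

Definition outside (S : set 'cV[int]_d) (z : 'cV[int]_d) : \bar R := (z \notin S)%:R%:E.

(** Probability that the strict descendants, within h generations, of a vertex
at z avoid A; see P_branch_and_progeny. *)
Fixpoint progeny_weight (h : nat) (z : 'cV[int]_d) : \bar R :=
  if h is h'.+1 then
    \esum_(k in [set: nat]) ((mu k)%:E *
      \prod_(j < k) forward_mean theta (fun z => outside A z * progeny_weight h' z) z)
  else 1.

Definition branch_weight (h : nat) : 'cV[int]_d -> \bar R :=
  forward_mean theta (fun z => outside A z * progeny_weight h z).

(** Under the size-biased law with a uniform heir, (j, i) has weight mu j for
every i < j, and the bush has i branches, or j - 1 - i on the other side. *)
Definition bush_weight (h : nat) (z : 'cV[int]_d) : \bar R :=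
  \esum_(j in [set: nat]) ((mu j)%:E * \sum_(i < j) \prod_(l < i) branch_weight h z).

Lemma measurable_coord i B : measurable (X i @^-1` B).
Proof. exact: indepX.1. Qed.

Lemma measurable_jump u B : measurable ((fun om => jump (E om) u) @^-1` B).
Proof. exact: (@measurable_coord (inr u) B). Qed.

Lemma measurable_kids u B : measurable ((fun om => kids (E om) u) @^-1` B).
Proof. exact: (@measurable_coord (inl u) [set x | B x.1]). Qed.

Lemma determined_jump S u B : S (inr u) ->
  determined_by X S ((fun om => jump (E om) u) @^-1` B).
Proof. by move=> Su; exact: (@determined_coord _ _ _ _ X _ (inr u)). Qed.

Lemma determined_kids S u B : S (inl u) ->
  determined_by X S ((fun om => kids (E om) u) @^-1` B).
Proof.
by move=> Su; exact: (@determined_coord _ _ _ _ X S (inl u) [set x | B x.1] Su).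
Qed.

Lemma determined_branch h u x :
  determined_by X (branch_coords u) [set om | branch_clear (E om) A h u x].
Proof.
elim: h u x => [|h IH] u x.
  rewrite (_ : mkset _ = (fun om => jump (E om) u) @^-1` [set y | ~ A (x + y)%R]).
    by apply: determined_jump; exists [::]; case: u.
  by apply/seteqP; split=> om /=; tauto.
have uu : branch_coords u (inr u) by exists [::]; case: u.
rewrite (_ : mkset _ =
  [set om | forall y, jump (E om) u = y -> ~ A (x + y)%R /\
    forall k, kids (E om) u = k -> forall j, (j < k)%N ->
      branch_clear (E om) A h (kid u j) (x + y)]).
  apply: determined_forall => y; apply: determined_imp.
    exact: (determined_jump [set z | z = y]).
  apply: determinedI; first exact: determined_const.
  apply: determined_forall => k; apply: determined_imp.
    by apply: (determined_kids [set z | z = k]); exists [::]; case: u {uu}.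
  apply: determined_forall => j; apply: determined_if => _.
  by apply: (determined_sub _ (IH _ _)); exact: branch_coords_kid.
apply/seteqP; split=> om /=.
  by move=> [nA H] _ <-; split=> // _ <-.
by move=> /(_ _ erefl)[nA H]; split=> //; exact: H.
Qed.

Lemma determined_progeny h u z :
  determined_by X (progeny_coords u) [set om | progeny_clear (E om) A h u z].
Proof.
case: h => [|h].
  by rewrite (_ : mkset _ = setT); [exact: determinedT|apply/seteqP; split].
rewrite (_ : mkset _ = [set om | forall k, kids (E om) u = k ->
    forall j, (j < k)%N -> branch_clear (E om) A h (kid u j) z]).
  apply: determined_forall => k; apply: determined_imp.
    by apply: (determined_kids [set z | z = k]); left.
  apply: determined_forall => j; apply: determined_if => _.
  by apply: (determined_sub _ (determined_branch _ _ _)) => i ij; right; exists j.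
by apply/seteqP; split=> om /=; [move=> H _ <-|move=> /(_ _ erefl)].
Qed.

(** The vertices whose number of children has law mu.  In particular
this includes c_0. *)
Definition ordinary (u : label) : Prop := forall k, (0 < k)%N -> u <> spine k.

Lemma ordinary_kid u j : ordinary (kid u j).
Proof. by move=> k _ []. Qed.

Lemma P_all_branches h (s : label) z n (c : pred nat) (q : \bar R) :
  (forall j, P [set om | branch_clear (E om) A h (kid s j) z] = q) ->
  P [set om | forall l, (l < n)%N -> c l -> branch_clear (E om) A h (kid s l) z] =
  \prod_(l < n | c l) q.
Proof.
move=> Pq; rewrite (P_forall_bounded indepX _ _ (S := fun l => branch_coords (kid s l))).
- by apply: eq_bigr => l _; rewrite Pq.
- by move=> l l' i; exact: branch_coords_inj.
- by move=> l; exact: determined_branch.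
Qed.

Lemma P_progeny_of_branch h u z (q : \bar R) : ordinary u ->
  (forall j, P [set om | branch_clear (E om) A h (kid u j) z] = q) ->
  P [set om | progeny_clear (E om) A h.+1 u z] =
  \esum_(k in [set: nat]) ((mu k)%:E * \prod_(j < k) q).
Proof.
move=> ou Pq; rewrite (total_probability P (measurable_kids u)); last first.
  exact: (measurable_determined indepX (determined_progeny _ _ _)).
apply: eq_esum => k _; case: TE => _ _ /(_ u k ou) <- _.
rewrite -(P_all_branches k xpredT Pq) -(determined_indep indepX
  (S := [set inl u]) (S' := \bigcup_j branch_coords (kid u j))).
- congr (P _); apply/seteqP; split=> om /= [<- H]; split=> // j jk; last exact: H.
  by move=> _; exact: H.
- by move=> i -> [j _ /branch_coords_kidN].
- exact: (determined_kids [set z | z = k]).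
- apply: determined_forall => j; apply: determined_if => _.
  apply: determined_if => _.
  by apply: (determined_sub _ (determined_branch _ _ _)) => i ij; exists j.
Qed.

Lemma P_outside_and z (F : set Omega) (S : set 'cV[int]_d) :
  P [set om | ~ S z /\ F om] = outside S z * P F.
Proof.
rewrite /outside; have [Sz|Sz] := boolP (z \in S).
  rewrite mul0e (_ : mkset _ = set0) ?measure0//.
  by apply/seteqP; split=> om //= [+ _]; move: Sz; rewrite inE.
rewrite mul1e; congr (P _); apply/seteqP; split=> om /=; first by case.
by split=> //; move: Sz; rewrite notin_setE.
Qed.

Lemma P_branch_and_progeny h :
  (forall u z, ordinary u ->
     P [set om | progeny_clear (E om) A h u z] = progeny_weight h z) /\
  (forall u x, ordinary u ->
     P [set om | branch_clear (E om) A h u x] = branch_weight h x).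
Proof.
have branch_of_progeny h' : (forall u z, ordinary u ->
     P [set om | progeny_clear (E om) A h' u z] = progeny_weight h' z) ->
  (forall u x, ordinary u ->
     P [set om | branch_clear (E om) A h' u x] = branch_weight h' x).
  move=> IH u x ou; rewrite (total_probability P (measurable_jump u)); last first.
    exact: (measurable_determined indepX (determined_branch _ _ _)).
  apply: eq_esum => y _; case: TE => _ _ _ /(_ u) <-.
  rewrite -(IH u (x + y)%R)// -P_outside_and -(determined_indep indepX
    (S := [set inr u]) (S' := progeny_coords u)).
  - by congr (P _); apply/seteqP; split=> om /= [<-]; rewrite branch_clearE.
  - by move=> i ->; exact: progeny_coordsN.
  - exact: (determined_jump [set z | z = y]).
  - by apply: determinedI; [exact: determined_const|exact: determined_progeny].
elim: h => [|h [_ IH]].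
  suff H u z : ordinary u ->
      P [set om | progeny_clear (E om) A 0 u z] = progeny_weight 0 z.
    by split=> //; exact: branch_of_progeny.
  by move=> _; rewrite (_ : mkset _ = setT) ?probability_setT//; apply/seteqP; split.
suff H u z : ordinary u ->
    P [set om | progeny_clear (E om) A h.+1 u z] = progeny_weight h.+1 z.
  by split=> //; exact: branch_of_progeny.
move=> ou; apply: P_progeny_of_branch => // j; apply: IH; exact: ordinary_kid.
Qed.

(** As the heir varies, a bush takes each of the sizes 0, ..., j - 1 once.  This
is all that matters of the side, so the left and right cases can be treated
together. *)
Definition side_balanced (side : nat -> nat -> bool) : Prop :=
  forall (q : \bar R) j, \sum_(i < j) \prod_(l < j | side i l) q = \sum_(i < j) \prod_(l < i) q.

Section Spine.
Variables (side : nat -> nat -> bool) (S : set 'cV[int]_d).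
Hypothesis sideP : side_balanced side.

Lemma measurable_spine_vertex k B :
  measurable ((fun om => (kids (E om) (spine k.+1), heir (E om) k.+1)) @^-1` B).
Proof. exact: (@measurable_coord (inl (spine k.+1)) B). Qed.

Lemma determined_spine_vertex S' k B : S' (inl (spine k.+1)) ->
  determined_by X S' ((fun om => (kids (E om) (spine k.+1), heir (E om) k.+1)) @^-1` B).
Proof. by move=> Su; exact: (@determined_coord _ _ _ _ X S' (inl (spine k.+1)) B Su). Qed.

Lemma determined_bush h k z :
  determined_by X (progeny_coords (spine k.+1)) [set om | bush_clear (E om) A side h k.+1 z].
Proof.
rewrite (_ : mkset _ = [set om | forall p : nat * nat,
    (kids (E om) (spine k.+1), heir (E om) k.+1) = p ->
    forall l, (l < p.1)%N -> side p.2 l -> branch_clear (E om) A h (kid (spine k.+1) l) z]).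
  apply: determined_forall => p; apply: determined_imp.
    by apply: (determined_spine_vertex [set z | z = p]); left.
  apply: determined_forall => l; apply: determined_if => _.
  apply: determined_if => _.
  by apply: (determined_sub _ (determined_branch _ _ _)) => i ij; right; exists l.
by apply/seteqP; split=> om /=; [move=> H _ <-|move=> /(_ _ erefl)].
Qed.

Lemma branch_weight_ge0 h x : 0 <= branch_weight h x.
Proof.
by case: (P_branch_and_progeny h) => _ /(_ (kid (spine 0) 0) x (@ordinary_kid _ _)) <-.
Qed.

(** The size-biased weight j * mu j and the uniform choice among j children
cancel, leaving mu j. *)
Lemma P_bush h k z :
  P [set om | bush_clear (E om) A side h k.+1 z] = bush_weight h z.
Proof.
set q := branch_weight h z.
have q0 : 0 <= q by exact: branch_weight_ge0.
have prod0 n (c : pred nat) : 0 <= \prod_(l < n | c l) q.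
  by elim/big_ind: _ => //; exact: mule_ge0.
rewrite (total_probability P (measurable_spine_vertex k)); last first.
  exact: (measurable_determined indepX (determined_bush _ _ _)).
transitivity (\esum_(p in [set: nat * nat]) ((mu p.1)%:E *
    ((p.2 < p.1)%N%:R%:E * \prod_(l < p.1 | side p.2 l) q))).
  apply: eq_esum => -[j i] _ /=.
  have -> : ((mu j)%:E * ((i < j)%N%:R%:E * \prod_(l < j | side i l) q)) =
     P ((fun om => (kids (E om) (spine k.+1), heir (E om) k.+1)) @^-1` [set (j, i)]) *
     P [set om | forall l, (l < j)%N -> side i l -> branch_clear (E om) A h (kid (spine k.+1) l) z].
    rewrite (P_all_branches j (side i) (q := q)); last first.
      by move=> l; apply: (P_branch_and_progeny h).2; exact: ordinary_kid.
    rewrite muleA; congr (_ * _); case: TE => _ H _ _.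
    rewrite (_ : _ @^-1` _ =
       [set om | kids (E om) (spine k.+1) = j /\ heir (E om) k.+1 = i]); last first.
      by apply/seteqP; split=> om /= [-> ->].
    rewrite H// -EFinM /size_biased; congr (_%:E).
    have [ij|] := ltnP i j; last by rewrite mul0r !mulr0.
    rewrite mulr1 mul1r mulrAC mulfV ?mul1r//.
    by rewrite pnatr_eq0 -lt0n (leq_ltn_trans _ ij).
  rewrite -(determined_indep indepX (S := [set inl (spine k.+1)])
    (S' := \bigcup_j branch_coords (kid (spine k.+1) j))).
  - by congr (P _); apply/seteqP; rewrite /bush_clear; split=> om /= [[-> ->]].
  - by move=> i' -> [l _ /branch_coords_kidN].
  - by apply: determined_spine_vertex.
  - apply: determined_forall => l; apply: determined_if => _.
    apply: determined_if => _.
    by apply: (determined_sub _ (determined_branch _ _ _)) => i' ij; exists l.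
rewrite (_ : [set: nat * nat] = [set: nat] `*`` (fun=> [set: nat])); last first.
  by apply/seteqP; split.
rewrite -(esum_esum (a := fun j i => (mu j)%:E *
    ((i < j)%N%:R%:E * \prod_(l < j | side i l) q))); last first.
  by move=> j i _ _; rewrite !mule_ge0 ?lee_fin ?offspring_ge0.
apply: eq_esum => j _; rewrite esumZl ?lee_fin ?offspring_ge0//; last first.
  by move=> i; rewrite mule_ge0 ?lee_fin.
by rewrite esum_lt// sideP.
Qed.

Lemma determined_spine m h k y :
  determined_by X (spine_coords k) [set om | spine_clear (E om) A side S m h k y].
Proof.
elim: m h k y => [|m IH] h k y; first exact: determined_const.
rewrite (_ : mkset _ =
  [set om | forall y', jump (E om) (spine k) = y' -> ~ S (y - y')%R /\
    (bush_clear (E om) A side h k.+1 (y - y') /\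
     spine_clear (E om) A side S m h.+1 k.+1 (y - y'))]); last first.
  by apply/seteqP; split=> om /=; [move=> H _ <-|move=> /(_ _ erefl)].
apply: determined_forall => y'; apply: determined_imp.
  by apply: (determined_jump [set z | z = y']); left.
apply: determinedI; first exact: determined_const.
apply: determinedI.
  apply: (determined_sub _ (determined_bush _ _ _)) => i [->|[l [w wE]]]; right=> //.
  by rewrite wE /=.
by apply: (determined_sub _ (IH _ _ _)) => i [->|ki]; right=> //=; exact: ltnW.
Qed.

(** Markov property of the spine: given the step to the next spine vertex, its
bush and the rest of the spine depend on disjoint sets of coordinates. *)
Lemma P_spine m h k y :
  P [set om | spine_clear (E om) A side S m h k y] =
  spine_weight theta (fun h z => outside S z * bush_weight h z) m h y.
Proof.
elim: m h k y => [|m IH] h k y.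
  rewrite (_ : mkset _ = setT) ?probability_setT//; by apply/seteqP; split.
rewrite (total_probability P (measurable_jump (spine k))); last first.
  exact: (measurable_determined indepX (determined_spine _ _ _ _)).
rewrite /= /backward_mean; apply: eq_esum => y' _.
case: TE => _ _ _ /(_ (spine k)) <-.
rewrite -/spine_weight -(IH h.+1 k.+1 (y - y')%R) -(P_bush h k) -muleA.
rewrite -(determined_indep indepX (S := progeny_coords (spine k.+1)) (S' := spine_coords k.+1)).
- rewrite -P_outside_and -(determined_indep indepX
    (S := [set inr (spine k)]) (S' := progeny_coords (spine k.+1) `|` spine_coords k.+1)).
  + by congr (P _); apply/seteqP; split=> om /= [<-].
  + by move=> i -> [[//|[l [w //=]]]|[[]|/=]]; [move=> [/eqP]; rewrite ltn_eqF|
      move/eqP; rewrite ltn_eqF|rewrite ltnNge leqnSn].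
  + exact: (determined_jump [set z | z = y']).
  + apply: determinedI; first exact: determined_const.
    apply: determinedI.
      by apply: (determined_sub _ (determined_bush _ _ _)) => i; left.
    by apply: (determined_sub _ (determined_spine _ _ _ _)) => i; right.
- move=> i [->|[l [w wE]]] [] //=; first by rewrite ltnn.
  + by move=> iE; move: wE; rewrite iE; case: w.
  + by rewrite wE ltnn.
- exact: determined_bush.
- exact: determined_spine.
Qed.

End Spine.

End Probabilities.

(** * Past and future in terms of labels *)

Section Labels.

Lemma iter_parent n k w : iter n parent (k, w) =
  if (n <= size w)%N then (k, drop n w) else spine (k + (n - size w)).
Proof.
elim: n k w => [|n IH] k w; first by rewrite drop0.
rewrite iterSr; case: w => [|j w] /=; rewrite IH //= ?subSS//.
by case: n {IH} => [|n] /=; rewrite ?addn1// !subn0 addSnnS.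
Qed.

Lemma ancestor_root u : ancestor u (spine 0) <-> exists n, u = spine n.
Proof.
split=> -[n ->]; exists n; first rewrite iter_parent /=.
  by case: n => [|n] //=; rewrite subn0 add0n.
by rewrite iter_parent /=; case: n => [|n] //=; rewrite subn0 add0n.
Qed.

Lemma ancestor_spine m k w : ancestor (spine m) (k, w) <-> (k <= m)%N.
Proof.
split.
  move=> [n]; rewrite iter_parent; case: leqP => _ [->] //; exact: leq_addr.
move=> km; exists (size w + (m - k))%N; rewrite iter_parent.
case: leqP => h; last by congr pair; lia.
have mk : m = k by lia.
by rewrite mk subnn addn0 drop_size.
Qed.

Lemma ancestor_branch m l k w :
  ancestor (m, [:: l]) (k, w) -> exists w', (k, w) = (m, w' ++ [:: l]).
Proof.
move=> [n]; rewrite iter_parent; case: leqP => _ [-> e] //.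
by exists (take n w); rewrite {1}e cat_take_drop.
Qed.

Lemma parent_spine u m : parent u = spine m ->
  (exists l, u = (m, [:: l])) \/ (exists2 p, u = spine p & m = p.+1).
Proof.
case: u => k [|j [|i w]] //= [<-]; first by right; exists k.
by left; exists j.
Qed.

Lemma last_common_ancestor_root k w l :
  last_common_ancestor (spine k.+1) (spine 0) (k.+1, w ++ [:: l]).
Proof.
split; [by apply/ancestor_root; exists k.+1|exact/ancestor_spine|].
by move=> w' /ancestor_root[n ->] /ancestor_spine kn; apply/ancestor_spine.
Qed.

Lemma last_common_ancestorC w u v :
  last_common_ancestor w u v -> last_common_ancestor w v u.
Proof. by move=> [wu wv H]; split=> // w' w'v w'u; exact: H. Qed.

Context {d : nat} (e : env d).

(** The last common ancestor of c_0 and of a vertex that is neither an ancestor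
nor a descendant of c_0 is a spine vertex c_{-k-1}, so the order is decided by comparing the rank of the child
of c_{-k-1} leading to the vertex with that of c_{-k}. *)
Lemma futureE u : future e u <-> tree e u /\
  ((exists2 w, w <> [::] & u = (0%N, w)) \/
   (exists k w l, u = (k.+1, w ++ [:: l]) /\ (heir e k.+1 < l)%N)).
Proof.
split=> -[tu H]; split=> //.
  move: H => [+ neq]; case: u tu neq => k w tu neq [|].
    move/ancestor_spine; rewrite leqn0 => /eqP k0; left; exists w; last by rewrite k0.
    by move=> w0; apply: neq; rewrite k0 w0.
  move=> [s [u' [v' [[+ _ _] [+ +] [+ +]]]]] => /ancestor_root[m ->].
  move=> pu' /ancestor_root[p u'E]; rewrite {}u'E in pu' *.
  case: m pu' => // m [<-] /parent_spine [[l ->]|[p' -> [<-]]]; last by rewrite ltnn.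
  by move=> /ancestor_branch[w' ->] /= lt; right; exists p, w', l.
split; last by case: H => [[w wn ->] []|[k [w [l [-> _]]]]] //; move/esym.
case: H => [[w wn ->]|[k [w [l [-> lt]]]]]; first by left; exact/ancestor_spine.
right; exists (spine k.+1), (spine k), (k.+1, [:: l]); split=> //.
- exact: last_common_ancestor_root.
- by split=> //; apply/ancestor_root; exists k.
- split=> //; exists (size w); rewrite iter_parent size_cat leq_addr.
  by rewrite drop_size_cat.
Qed.

Lemma pastE u : past e u <-> tree e u /\
  ((exists k, u = spine k.+1) \/
   (exists k w l, u = (k.+1, w ++ [:: l]) /\ (l < heir e k.+1)%N)).
Proof.
split=> -[tu H]; split=> //.
  move: H => [+ neq]; case: u tu neq => k w tu neq [|].
    by move/ancestor_root=> [[|n] uE]; [case: neq|left; exists n].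
  move=> [s [v' [u' [[_ + _] [+ +] [+ +]]]]] => /ancestor_root[m ->].
  move=> pv' av' pu' /ancestor_root[p u'E]; rewrite {}u'E in pu' *.
  case: m pu' pv' => // m [<-] /parent_spine [[l v'E]|[p' v'E [pp']]].
    by move: av'; rewrite v'E => /ancestor_branch[w' ->] /= lt; right; exists p, w', l.
  by rewrite v'E pp' ltnn.
split; last by case: H => [[k ->] []|[k [w [l [-> _]]]]].
case: H => [[k ->]|[k [w [l [-> lt]]]]].
  by left; apply/ancestor_root; exists k.+1.
right; exists (spine k.+1), (k.+1, [:: l]), (spine k); split=> //.
- exact/last_common_ancestorC/last_common_ancestor_root.
- split=> //; exists (size w); rewrite iter_parent size_cat leq_addr.
  by rewrite drop_size_cat.
- by split=> //; apply/ancestor_root; exists k.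
Qed.

Variables (A : set 'cV[int]_d) (a : 'cV[int]_d).

Lemma in_tree_suffix k w w' : in_tree_at e k (w ++ w') -> in_tree_at e k w'.
Proof. by elim: w => //= j w IH /and3P[/IH]. Qed.

Lemma branch_clearP h k j w0 : in_tree_at e k (j :: w0) ->
  branch_clear e A h (k, j :: w0) (tree_walk_at e a k w0) <->
  forall w, (size w <= h)%N -> in_tree_at e k (w ++ j :: w0) ->
    ~ A (tree_walk_at e a k (w ++ j :: w0)).
Proof.
elim: h j w0 => [|h IH] j w0 tj.
  split; first by move=> [nA _] [|//].
  by move=> H; split=> //; exact: (H [::]).
split.
  move=> [nA H] w; case/lastP: w => [//|w l]; rewrite size_rcons ltnS cat_rcons => sw tw.
  have tl := in_tree_suffix tw.
  by have /(_ _)/IH := H l; apply=> //; case/and3P: tl.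
move=> H; split; first exact: (H [::]).
move=> l lk; apply/IH.
  by move: tj => /=; rewrite lk => ->; rewrite andbF.
by move=> w sw; rewrite -cat_rcons => tw; apply: H => //; rewrite size_rcons.
Qed.

Lemma progeny_clearP h : progeny_clear e A h (spine 0) a <->
  forall w, w <> [::] -> (size w <= h)%N -> in_tree_at e 0 w ->
    ~ A (tree_walk_at e a 0 w).
Proof.
have a0 : tree_walk_at e a 0 [::] = a by exact: tree_walk_root.
case: h => [|h]; first by split=> // _ [].
split.
  move=> H w; case/lastP: w => [//|w l] _; rewrite size_rcons ltnS -cats1 => sw tw.
  have tl := in_tree_suffix tw.
  have : branch_clear e A h (0%N, [:: l]) a by apply: H; case/and3P: tl.
  by rewrite -{1}a0 => /branch_clearP; apply.
move=> H l lk; rewrite -[a in branch_clear _ _ _ _ a]a0; apply/branch_clearP.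
  by rewrite /= lk.
by move=> w sw tw; apply: H => //; [case: (w)|rewrite size_cat addn1].
Qed.

Lemma spine_clearP (side : nat -> nat -> bool) S m h k : (forall i l, side i l -> l != i) ->
  spine_clear e A side S m h k (tree_walk_at e a k [::]) <->
  forall k', (k' < m)%N -> ~ S (tree_walk_at e a (k + k').+1 [::]) /\
    forall l w, side (heir e (k + k').+1) l -> (size w <= h + k')%N ->
      in_tree_at e (k + k').+1 (w ++ [:: l]) ->
      ~ A (tree_walk_at e a (k + k').+1 (w ++ [:: l])).
Proof.
move=> sideN; elim: m h k => [|m IH] h k; first by split.
have step : tree_walk_at e a k [::] - jump e (spine k) = tree_walk_at e a k.+1 [::].
  by rewrite /= big_ord_recr /= opprD addrA.
have bushP : bush_clear e A side h k.+1 (tree_walk_at e a k.+1 [::]) <->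
    forall l w, side (heir e k.+1) l -> (size w <= h)%N ->
      in_tree_at e k.+1 (w ++ [:: l]) -> ~ A (tree_walk_at e a k.+1 (w ++ [:: l])).
  split.
    move=> H l w sl sw tw; have tl := in_tree_suffix tw.
    move: w sw tw {IH}; apply/branch_clearP => //; apply: H => //.
    by case/and3P: tl.
  move=> H l lk sl; apply/branch_clearP; first by rewrite /= lk sideN.
  by move=> w; exact: H.
rewrite [spine_clear _ _ _ _ _ _ _ _]/= -/(spine_clear _ _ _ _ _ _ _ _) step.
split.
  move=> [nS [/bushP bush /IH up]] [|k'] k'm.
    by rewrite !addn0.
  by rewrite -!addSnnS; apply: up.
move=> H; split; first by have := (H 0%N isT).1; rewrite addn0.
split; first by apply/bushP; have := (H 0%N isT).2; rewrite !addn0.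
by apply/IH => k' k'm; rewrite !addSnnS; exact: H.
Qed.

End Labels.

(** * Truncations of the past and of the future *)

Definition elder (i l : nat) := (l < i)%N.
Definition younger (i l : nat) := (i < l)%N.

(** The spine vertices themselves belong to the past, hence the set0 here and
the A in past_clear. *)
Definition future_clear {d : nat} (e : env d) A m h a :=
  progeny_clear e A h (spine 0) a /\ spine_clear e A younger set0 m h 0 a.

Definition past_clear {d : nat} (e : env d) A m h a :=
  spine_clear e A elder A m h 0 a.

Section Truncations.
Context {d : nat} (e : env d) (A : set 'cV[int]_d) (a : 'cV[int]_d).

Lemma spine_clear_decr (side : nat -> nat -> bool) S m h m' h' : (forall i l, side i l -> l != i) ->
  (m <= m')%N -> (h <= h')%N ->
  spine_clear e A side S m' h' 0 a -> spine_clear e A side S m h 0 a.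
Proof.
move=> sideN mm' hh'; rewrite -(tree_walk_root e a) => /(spine_clearP _ _ _ _ _ _ _ sideN) H.
apply/spine_clearP => // k' k'm; have [nS B] := H k' (leq_trans k'm mm').
by split=> // l w sl sw; apply: B => //; lia.
Qed.

Lemma elderN i l : elder i l -> l != i. Proof. by rewrite /elder; lia. Qed.
Lemma youngerN i l : younger i l -> l != i. Proof. by rewrite /younger; lia. Qed.

Lemma future_clear_decr m h m' h' : (m <= m')%N -> (h <= h')%N ->
  future_clear e A m' h' a -> future_clear e A m h a.
Proof.
move=> mm' hh' [/progeny_clearP H B]; split.
  by apply/progeny_clearP => w wn sw; apply: H => //; lia.
by move: B; apply: spine_clear_decr => //; exact: youngerN.
Qed.

Lemma past_clear_decr m h m' h' : (m <= m')%N -> (h <= h')%N ->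
  past_clear e A m' h' a -> past_clear e A m h a.
Proof. by move=> mm' hh'; apply: spine_clear_decr => //; exact: elderN. Qed.

Lemma visited_disjoint V :
  visited e a V `&` A = set0 <-> forall u, V u -> ~ A (tree_walk e a u).
Proof.
split=> [H u Vu Au|H].
  suff : (visited e a V `&` A) (tree_walk e a u) by rewrite H.
  by split=> //; exists u.
by apply/seteqP; split=> // _ [[u Vu <-] /(H _ Vu)].
Qed.

Lemma future_disjointE : visited e a (future e) `&` A = set0 <->
  forall n, future_clear e A n n a.
Proof.
split.
  move=> /visited_disjoint H n; split.
    apply/progeny_clearP => w wn _ tw; apply: (H (0%N, w)); apply/futureE.
    by split=> //; left; exists w.
  rewrite -(tree_walk_root e a); apply/spine_clearP; first exact: youngerN.
  move=> k _; split=> // l w sl _ tw; apply: (H (k.+1, w ++ [:: l])); apply/futureE.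
  by split=> //; right; exists k, w, l.
move=> H; apply/visited_disjoint => u /futureE[tu [[w wn uE]|[k [w [l [uE kl]]]]]].
  have [/progeny_clearP P _] := H (size w).
  by rewrite uE; apply: P => //; move: tu; rewrite uE.
have [_] := H (maxn k.+1 (size w)).
rewrite -{1}(tree_walk_root e a) => /(spine_clearP _ _ _ _ _ _ _ youngerN).
move=> /(_ k); rewrite leq_maxl => /(_ isT)[_ /(_ l w kl)].
by rewrite uE; apply; [exact: leq_trans (leq_maxr _ _) (leq_addr _ _)|move: tu; rewrite uE].
Qed.

Lemma past_disjointE : visited e a (past e) `&` A = set0 <->
  forall n, past_clear e A n n a.
Proof.
split.
  move=> /visited_disjoint H n.
  rewrite /past_clear -(tree_walk_root e a); apply/spine_clearP; first exact: elderN.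
  move=> k _; split.
    by apply: (H (spine k.+1)); apply/pastE; split=> //; left; exists k.
  move=> l w sl _ tw; apply: (H (k.+1, w ++ [:: l])); apply/pastE.
  by split=> //; right; exists k, w, l.
move=> H; apply/visited_disjoint => u /pastE[tu [[k uE]|[k [w [l [uE kl]]]]]].
  have := H k.+1.
  rewrite /past_clear -{1}(tree_walk_root e a) => /(spine_clearP _ _ _ _ _ _ _ elderN).
  by move=> /(_ k (ltnSn _)) [+ _]; rewrite uE.
have := H (maxn k.+1 (size w)).
rewrite /past_clear -{1}(tree_walk_root e a) => /(spine_clearP _ _ _ _ _ _ _ elderN).
move=> /(_ k); rewrite leq_maxl => /(_ isT)[_ /(_ l w kl)].
by rewrite uE; apply; [exact: leq_trans (leq_maxr _ _) (leq_addr _ _)|move: tu; rewrite uE].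
Qed.

End Truncations.

(** * From antidiagonal sums to limits *)

Section Limit.
Context {R : realType} {dO : measure_display} {Omega : measurableType dO}
  (P : probability Omega R) {V : choiceType}.
Variable A : set V.
Hypothesis finA : finite_set A.
Local Open Scope ereal_scope.
Implicit Types C : nat -> nat -> V -> set Omega.

Lemma sum_P_fine (F : V -> set Omega) : (forall a, measurable (F a)) ->
  \sum_(a \in A) P (F a) = (\sum_(a <- finmap.enum_fset (fset_set A)) fine (P (F a)))%R%:E.
Proof.
move=> mF; rewrite fsbig_finite// -sumEFin; apply: eq_bigr => a _.
by rewrite fineK// fin_num_measure.
Qed.

Definition antitone C := forall m h m' h' a, (m <= m')%N -> (h <= h')%N ->
  C m' h' a `<=` C m h a.

Lemma limit_le C C' (D D' : V -> set Omega) :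
  (forall m h a, measurable (C m h a)) -> (forall m h a, measurable (C' m h a)) ->
  antitone C -> antitone C' ->
  (forall a, D a = \bigcap_n C n n a) -> (forall a, D' a = \bigcap_n C' n n a) ->
  (forall n, \sum_(i < n.+1) \sum_(a \in A) P (C i (n - i)%N a) =
             \sum_(i < n.+1) \sum_(a \in A) P (C' i (n - i)%N a)) ->
  \sum_(a \in A) P (D' a) <= \sum_(a \in A) P (D a).
Proof.
move=> mC mC' decC decC' DE D'E eqC.
have mD a : measurable (D a) by rewrite DE; exact: bigcapT_measurable.
have mD' a : measurable (D' a) by rewrite D'E; exact: bigcapT_measurable.
rewrite !sum_P_fine// lee_fin.
pose arr (K : nat -> nat -> V -> set Omega) (m h : nat) : R :=
  (\sum_(a <- finmap.enum_fset (fset_set A)) fine (P (K m h a)))%R.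
apply: (@antidiagonal_cesaro_le _ (arr C) (arr C')).
- move=> m h m' h' mm' hh'; apply: ler_sum => a _; apply: fine_le.
  + exact: fin_num_measure.
  + exact: fin_num_measure.
  + by apply: le_measure; [exact/mem_set|exact/mem_set|exact: decC].
- move=> m h; apply: ler_sum => a _; apply: fine_le.
  + exact: fin_num_measure.
  + exact: fin_num_measure.
  + apply: le_measure; [exact/mem_set|exact/mem_set|].
    rewrite D'E => om /(_ (maxn m h) Logic.I).
    by apply: decC'; rewrite ?leq_maxl ?leq_maxr.
- move=> n; apply: EFin_inj; rewrite -!sumEFin.
  under eq_bigr do rewrite -sum_P_fine//.
  by rewrite eqC; under eq_bigr do rewrite sum_P_fine//.
- rewrite /arr; apply: cvg_big => [|a _]; first exact: add_continuous.
  apply: fine_cvg; rewrite fineK ?fin_num_measure// DE.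
  apply: (@nonincreasing_cvg_mu _ _ _ P (fun n => C n n a)) => //.
  + by rewrite ltey_eq fin_num_measure.
  + by rewrite -DE.
  + by move=> m n mn; apply/subsetPset; exact: decC.
Qed.

End Limit.

(** * The two renewal equations for the hitting probability *)

Section HittingProbability.
Context {R : realType} {d : nat} {dO : measure_display}
  {Omega : measurableType dO} (P : probability Omega R).
Local Open Scope ereal_scope.

(** A subtraction-free form of 1 - q^k = (1 - q) (1 + q + ... + q^(k-1)), convenient
in the extended reals. *)
Lemma geometric_split (q t : \bar R) k : 0 <= q -> 0 <= t -> t + q = 1 ->
  \prod_(j < k) q + t * \sum_(i < k) \prod_(l < i) q = 1.
Proof.
move=> q0 t0 tq; have pr0 n : 0 <= \prod_(l < n) q.
  by elim/big_ind: _ => //; exact: mule_ge0.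
elim: k => [|k IH]; first by rewrite !big_ord0 mule0 adde0.
have su0 : 0 <= \sum_(i < k) \prod_(l < i) q by apply: sume_ge0 => i _.
rewrite big_ord_recr /= [X in _ + _ * X]big_ord_recr /= [t * _]ge0_muleDr ?pr0//.
by rewrite addeCA [t * \prod_(_ < _) _]muleC -ge0_muleDr// [q + t]addeC tq mule1 addeC.
Qed.

Variables (mu : nat -> R) (theta : 'cV[int]_d -> R) (E : Omega -> env d).
Variable A : set 'cV[int]_d.
Hypothesis finA : finite_set A.
Hypotheses (mu_law : is_law mu) (theta_law : is_law theta).
Hypothesis TE : is_Tinfty_walk P mu theta E.

Let mu0 k : (0 <= mu k)%R. Proof. exact: mu_law.1. Qed.
Let theta0 y : (0 <= theta y)%R. Proof. exact: theta_law.1. Qed.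
Notation progeny := (progeny_weight mu theta A).
Notation branch := (branch_weight mu theta A).
Notation bush := (bush_weight mu theta A).

Lemma outside_ge0 S (z : 'cV[int]_d) : 0 <= outside S z :> \bar R.
Proof. by rewrite lee_fin. Qed.

Lemma progeny_weight_P h z :
  progeny h z = P [set om | progeny_clear (E om) A h (spine 0) z].
Proof. by rewrite ((P_branch_and_progeny A TE h).1 (spine 0))// => -[]. Qed.

Lemma progeny_weight_ge0 h z : 0 <= progeny h z.
Proof. by rewrite progeny_weight_P. Qed.

Lemma progeny_weight_fin h z : progeny h z \is a fin_num.
Proof.
rewrite progeny_weight_P fin_num_measure//.
by case: TE => iX _ _ _; apply: (measurable_determined iX (determined_progeny E A h (spine 0) z)).
Qed.

(** The probability that the tree of height h started at z, root included, meets
A. *)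
Definition hit (h : nat) (z : 'cV[int]_d) : \bar R :=
  if z \in A then 1 else 1 - progeny h z.

Lemma hit_ge0 h z : 0 <= hit h z.
Proof.
rewrite /hit; case: ifP => // _; rewrite sube_ge0 ?progeny_weight_fin//.
rewrite progeny_weight_P probability_le1//.
by case: TE => iX _ _ _; apply: (measurable_determined iX (determined_progeny E A h (spine 0) z)).
Qed.

Lemma hit_outside h z : hit h z + outside A z * progeny h z = 1.
Proof.
rewrite /hit /outside; case: ifP => _; first by rewrite mul0e adde0.
by rewrite mul1e subeK// progeny_weight_fin.
Qed.

Lemma mean_hit_branch h z : forward_mean theta (hit h) z + branch h z = 1.
Proof.
rewrite /branch_weight /forward_mean -esumD; last 2 first.
- by move=> y _; rewrite mule_ge0 ?lee_fin ?hit_ge0.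
- by move=> y _; rewrite !mule_ge0 ?lee_fin ?progeny_weight_ge0.
rewrite -[RHS]theta_law.2; apply: eq_esum => y _.
by rewrite -ge0_muleDr ?hit_outside ?mule1 ?hit_ge0 ?mule_ge0 ?outside_ge0 ?progeny_weight_ge0.
Qed.

Lemma mean_hit_ge0 h z : 0 <= forward_mean theta (hit h) z.
Proof. by apply: forward_mean_ge0 => // y; exact: hit_ge0. Qed.

Lemma branch_ge0 h z : 0 <= branch h z.
Proof. exact: (branch_weight_ge0 _ TE). Qed.

Lemma prod_branch_ge0 h z n : 0 <= \prod_(j < n) branch h z.
Proof. by elim/big_ind: _ => [//|x y|*]; [exact: mule_ge0|exact: branch_ge0]. Qed.

Lemma sum_prod_branch_ge0 h z n : 0 <= \sum_(i < n) \prod_(j < i) branch h z.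
Proof. by apply: sume_ge0 => i _; exact: prod_branch_ge0. Qed.

Lemma bush_weight_ge0 h z : 0 <= bush h z.
Proof. by apply: esum_ge0 => j _; rewrite mule_ge0 ?lee_fin ?sum_prod_branch_ge0. Qed.

(** Among k children whose branches independently meet A with probability t,
the first one to do so, if any, is preceded by i branches that avoid A; summing
over the rank i and over k turns mu into bush. *)
Lemma progeny_weightS h z :
  progeny h.+1 z + bush h z * forward_mean theta (hit h) z = 1.
Proof.
rewrite muleC /bush_weight -esumZl ?mean_hit_ge0//; last first.
  by move=> k; rewrite mule_ge0 ?lee_fin ?sum_prod_branch_ge0.
rewrite [progeny _ _]/= -esumD; last 2 first.
- by move=> k _; rewrite mule_ge0 ?lee_fin ?prod_branch_ge0.
- by move=> k _; rewrite !mule_ge0 ?lee_fin ?mean_hit_ge0 ?sum_prod_branch_ge0.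
rewrite -[RHS]mu_law.2; apply: eq_esum => k _.
rewrite -/(branch h z) muleCA -ge0_muleDr ?prod_branch_ge0//; last first.
  by rewrite mule_ge0 ?mean_hit_ge0 ?sum_prod_branch_ge0.
by rewrite geometric_split ?mule1 ?branch_ge0 ?mean_hit_ge0// mean_hit_branch.
Qed.

Definition inside (z : 'cV[int]_d) : \bar R := (z \in A)%:R%:E.

Lemma esum_inside (f : 'cV[int]_d -> \bar R) : (forall x, 0 <= f x) ->
  \esum_(x in setT) (inside x * f x) = \sum_(a \in A) f a.
Proof.
move=> f0; rewrite -esum_fset// [RHS]esum_mkcond.
by apply: eq_esum => x _; rewrite /inside; case: ifP; rewrite ?mul1e ?mul0e.
Qed.

(** Decomposition at the first visit in depth-first order: either the root is
visited, or it is not and the first child whose branch meets A is chosen. *)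
Lemma hit_past h z :
  hit h.+1 z = inside z + outside A z * bush h z * forward_mean theta (hit h) z.
Proof.
rewrite /hit /inside /outside; case: ifP => _; first by rewrite !mul0e adde0.
rewrite mul1e add0e -[X in X - _](progeny_weightS h z) [X in X - _]addeC addeK//.
exact: progeny_weight_fin.
Qed.

(** Decomposition at the last visit: either no strict descendant of the root
meets A, and the root itself lies in A, or the last child whose branch meets A
is chosen, with no condition on the root. *)
Lemma hit_future h z :
  hit h.+1 z = inside z * progeny h.+1 z + outside set0 z * bush h z * forward_mean theta (hit h) z.
Proof.
have -> : outside set0 z = 1 :> \bar R by rewrite /outside in_set0.
rewrite mul1e /hit /inside; case: ifP => _; first by rewrite mul1e progeny_weightS.
rewrite mul0e add0e -[X in X - _](progeny_weightS h z) [X in X - _]addeC addeK//.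
exact: progeny_weight_fin.
Qed.

Lemma elder_balanced : side_balanced (R := R) elder.
Proof.
move=> q j; apply: eq_bigr => i _.
by rewrite (big_ord_widen_cond j xpredT (fun=> q) (ltnW (ltn_ord i))).
Qed.

Lemma younger_balanced : side_balanced (R := R) younger.
Proof.
move=> q j; rewrite -elder_balanced (reindex_inj rev_ord_inj) /=.
apply: eq_bigr => i _; rewrite [LHS](reindex_inj rev_ord_inj) /=.
apply: eq_bigl => l; rewrite /younger /elder.
by have := ltn_ord l; have := ltn_ord i; lia.
Qed.

Definition future_event m h a := [set om | future_clear (E om) A m h a].
Definition past_event m h a := [set om | past_clear (E om) A m h a].

Lemma P_past m h a :
  P (past_event m h a) = spine_weight theta (fun h z => outside A z * bush h z) m h a.
Proof. exact: (P_spine A TE A elder_balanced). Qed.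

Lemma P_future m h a : P (future_event m h a) =
  progeny h a * spine_weight theta (fun h z => outside set0 z * bush h z) m h a.
Proof.
case: (TE) => iX _ _ _.
rewrite -(P_spine A TE set0 younger_balanced m h 0 a) progeny_weight_P.
rewrite -(determined_indep iX (S := progeny_coords (spine 0)) (S' := spine_coords 0)) //.
- move=> i [->|[j [w wE]]] [] //=.
    by move=> iE; move: wE; rewrite iE; case: w.
  by rewrite wE.
- exact: determined_progeny.
- exact: determined_spine.
Qed.

(** Both sides expand the sum over all starting points z of hit n z. *)
Lemma antidiagonal_identity n :
  \sum_(i < n.+1) \sum_(a \in A) P (future_event i (n - i)%N a) =
  \sum_(i < n.+1) \sum_(a \in A) P (past_event i (n - i)%N a).
Proof.
have g_ge0 S k x : 0 <= outside S x * bush k x.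
  by rewrite mule_ge0 ?outside_ge0 ?bush_weight_ge0.
have w_ge0 S m h z :
    0 <= spine_weight theta (fun h z => outside S z * bush h z) m h z.
  exact: spine_weight_ge0.
have inside_ge0 z : 0 <= inside z by rewrite lee_fin.
have hit0 z : hit 0 z = inside z.
  by rewrite /hit /inside /=; case: ifP => // _; rewrite subee.
have future0 z : hit 0 z = inside z * progeny 0 z by rewrite hit0 mule1.
have future_ge0 h z : 0 <= inside z * progeny h z by rewrite mule_ge0 ?progeny_weight_ge0.
have pairing_future := renewal_pairing theta0 hit_ge0 future_ge0
  (g_ge0 set0) future0 hit_future 0 n.
have pairing_past := renewal_pairing theta0 hit_ge0 (fun=> inside_ge0)
  (g_ge0 A) hit0 hit_past 0 n.
transitivity (\esum_(x in setT) (hit n x * 1)).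
  rewrite [RHS]pairing_future; apply: eq_bigr => i _.
  rewrite -esum_inside//; apply: eq_esum => x _.
  by rewrite P_future muleA.
rewrite [LHS]pairing_past; apply: eq_bigr => i _.
rewrite -esum_inside//; apply: eq_esum => x _.
by rewrite P_past.
Qed.

Lemma future_past_sum :
  \sum_(a \in A) P [set om | visited (E om) a (future (E om)) `&` A = set0] =
  \sum_(a \in A) P [set om | visited (E om) a (past (E om)) `&` A = set0].
Proof.
have mF m h a : measurable (future_event m h a).
  case: (TE) => iX _ _ _.
  rewrite (_ : future_event m h a =
    [set om | progeny_clear (E om) A h (spine 0) a] `&`
    [set om | spine_clear (E om) A younger set0 m h 0 a])//.
  apply: measurableI.
    exact: (measurable_determined iX (determined_progeny E A h (spine 0) a)).
  exact: (measurable_determined iX (determined_spine E A younger set0 m h 0 a)).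
have mP m h a : measurable (past_event m h a).
  case: (TE) => iX _ _ _.
  exact: (measurable_determined iX (determined_spine E A elder A m h 0 a)).
have dF : antitone future_event.
  by move=> m h m' h' a mm' hh' om; exact: future_clear_decr.
have dP : antitone past_event.
  by move=> m h m' h' a mm' hh' om; exact: past_clear_decr.
have FE a : [set om | visited (E om) a (future (E om)) `&` A = set0] =
    \bigcap_n future_event n n a.
  by apply/seteqP; split=> om /=; rewrite future_disjointE => H n; [move=> _|]; exact: H.
have PE a : [set om | visited (E om) a (past (E om)) `&` A = set0] =
    \bigcap_n past_event n n a.
  by apply/seteqP; split=> om /=; rewrite past_disjointE => H n; [move=> _|]; exact: H.
apply/eqP; rewrite eq_le; apply/andP; split.
  by apply: (limit_le finA mP mF dP dF PE FE) => n; rewrite antidiagonal_identity.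
by apply: (limit_le finA mF mP dF dP FE PE) => n; exact: antidiagonal_identity.
Qed.

End HittingProbability.

Unset Implicit Arguments.

Theorem proposition1p12 (R : realType) (d : nat)
    (mu : nat -> R) (alpha : R) (L : R -> R)
    (theta : 'cV[int]_d -> R) (Sigma : 'M[R]_d)
    (dO : measure_display) (Omega : measurableType dO)
    (P : probability Omega R) (E : Omega -> env d) :
  critical mu -> 1 < alpha -> alpha <= 2 -> in_dom mu alpha L ->
  jump_law theta Sigma -> green_asymptotics theta Sigma ->
  (d%:R > 2 * alpha / (alpha - 1)) \/
  (d%:R = 2 * alpha / (alpha - 1) /\
   (\sum_(1 <= n <oo) (L (n%:R `^ (2 / (alpha - 1))) / n%:R)%:E < +oo)%E) ->
  finite_moment theta d.-1 ->
  is_Tinfty_walk P mu theta E ->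
  forall A : set 'cV[int]_d, finite_set A ->
  BCap P E A =
  (\sum_(a \in A)
     P [set om | (visited (E om) a (past (E om)) `&` A = set0)%classic])%E.
Proof.
move=> [mu_law _ _] _ _ _ [theta_law _ _ _ _] _ _ _ TE A finA.
exact: future_past_sum finA mu_law theta_law TE.
Qed.
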